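(* Let $\Bbbk$ be a field, and let $\mathcal{C}$ be a Cauchy complete $\Bbbk$-linear braided monoidal category with finite dimensional morphism spaces and $\operatorname{End}(\mathbf{1})=\Bbbk$. If $\mathcal{C}$ is semisimple, is an r-category, and has moderate growth, then $\mathcal{C}$ is rigid, i.e., every object of $\mathcal{C}$ is rigid.
   Context: A linear category is Cauchy complete if it admits (finite) direct sums and is idempotent (Karoubi) complete. $\mathbf{1}$ denotes the monoidal unit. An r-category is a monoidal category $\mathcal{C}$ such that for every $X\in\mathcal{C}$ the functor $Z\mapsto \operatorname{Hom}(Z\otimes X,\mathbf{1})$ is representable by some object $X^*$ (so $\operatorname{Hom}(Z\otimes X,\mathbf 1)\cong\operatorname{Hom}(Z,X^* )$ naturally in $Z$), and the resulting functor $*:\mathcal{C}\to\mathcal{C}^{\rm mop}$ (the category with both tensor product and arrows reversed) is an equivalence. An object $X$ has moderate growth if there exists $n\in\mathbb{N}$ such that $\dim_{\Bbbk}\operatorname{End}(X^{\otimes n})<n!$; the category $\mathcal{C}$ has moderate growth if all its indecomposable objects do. An object is rigid if it admits a left dual and a right dual. *)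

(* Defs.v *)
From HB Require Import structures.
From mathcomp Require Import all_boot all_order all_algebra.

Set Implicit Arguments.
Unset Strict Implicit.
Unset Printing Implicit Defensive.

Import GRing.Theory.
Local Open Scope ring_scope.

Declare Scope cat_scope.
Delimit Scope cat_scope with C.
Local Open Scope cat_scope.

(* The morphism spaces are finite dimensional by construction: [vectType k]
   is the structure of finite-dimensional k-vector spaces. *)
Record linear_category (k : fieldType) := LinearCategory {
  obj :> Type;
  hom : obj -> obj -> vectType k;
  idm : forall X : obj, hom X X;
  comp : forall X Y Z : obj, hom Y Z -> hom X Y -> hom X Z;
  comp_idl : forall (X Y : obj) (f : hom X Y), comp (idm Y) f = f;
  comp_idr : forall (X Y : obj) (f : hom X Y), comp f (idm X) = f;
  compA : forall (W X Y Z : obj) (h : hom Y Z) (g : hom X Y) (f : hom W X),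
    comp h (comp g f) = comp (comp h g) f;
  comp_linearl : forall (X Y Z : obj) (f : hom X Y),
    linear (fun g : hom Y Z => comp g f);
  comp_linearr : forall (X Y Z : obj) (g : hom Y Z),
    linear (fun f : hom X Y => comp g f)
}.

Arguments hom {k l} _ _.
Arguments idm {k l} X.
Arguments comp {k l X Y Z} g f.

Notation "g ∘ f" := (comp g f) (at level 40, left associativity) : cat_scope.

Record iso (k : fieldType) (C : linear_category k) (X Y : C) := Iso {
  fwd :> hom X Y;
  bwd : hom Y X;
  bwdK : bwd ∘ fwd = idm X;
  fwdK : fwd ∘ bwd = idm Y
}.

Definition is_iso (k : fieldType) (C : linear_category k) (X Y : C)
    (f : hom X Y) : Prop :=
  exists g : hom Y X, g ∘ f = idm X /\ f ∘ g = idm Y.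

Definition mono (k : fieldType) (C : linear_category k) (X Y : C)
    (f : hom X Y) : Prop :=
  forall (Z : C) (g h : hom Z X), f ∘ g = f ∘ h -> g = h.

Definition epi (k : fieldType) (C : linear_category k) (X Y : C)
    (f : hom X Y) : Prop :=
  forall (Z : C) (g h : hom Y Z), g ∘ f = h ∘ f -> g = h.

(* Initial and terminal. *)
Definition is_zero (k : fieldType) (C : linear_category k) (X : C) : Prop :=
  forall Y : C, (forall f : hom X Y, f = 0) /\ (forall f : hom Y X, f = 0).

(* The empty direct sum ([I] empty) is a zero object. *)
Definition is_direct_sum (k : fieldType) (C : linear_category k)
    (I : finType) (S : I -> C) (X : C) : Prop :=
  exists (inj : forall i : I, hom (S i) X) (prj : forall i : I, hom X (S i)),
    [/\ forall i, prj i ∘ inj i = idm (S i),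
        forall i j, i <> j -> prj j ∘ inj i = 0
      & \sum_(i : I) inj i ∘ prj i = idm X].

Definition has_direct_sums (k : fieldType) (C : linear_category k) : Prop :=
  forall (I : finType) (S : I -> C), exists X : C, is_direct_sum S X.

Definition idempotent_complete (k : fieldType) (C : linear_category k) : Prop :=
  forall (X : C) (e : hom X X), e ∘ e = e ->
    exists (Y : C) (r : hom X Y) (s : hom Y X), s ∘ r = e /\ r ∘ s = idm Y.

Definition cauchy_complete (k : fieldType) (C : linear_category k) : Prop :=
  has_direct_sums C /\ idempotent_complete C.

Definition is_kernel (k : fieldType) (C : linear_category k) (K X Y : C)
    (i : hom K X) (f : hom X Y) : Prop :=
  f ∘ i = 0 /\
  forall (Z : C) (g : hom Z X), f ∘ g = 0 -> exists! h : hom Z K, i ∘ h = g.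

Definition is_cokernel (k : fieldType) (C : linear_category k) (X Y Q : C)
    (p : hom Y Q) (f : hom X Y) : Prop :=
  p ∘ f = 0 /\
  forall (Z : C) (g : hom Y Z), g ∘ f = 0 -> exists! h : hom Q Z, h ∘ p = g.

Definition abelian (k : fieldType) (C : linear_category k) : Prop :=
  [/\ has_direct_sums C,
      forall (X Y : C) (f : hom X Y), exists (K : C) (i : hom K X),
        is_kernel i f,
      forall (X Y : C) (f : hom X Y), exists (Q : C) (p : hom Y Q),
        is_cokernel p f,
      forall (X Y : C) (f : hom X Y), mono f ->
        exists (Z : C) (g : hom Y Z), is_kernel f g
    & forall (X Y : C) (f : hom X Y), epi f ->
        exists (Z : C) (g : hom Z X), is_cokernel f g].

Definition simple (k : fieldType) (C : linear_category k) (X : C) : Prop :=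
  ~ is_zero X /\
  forall (Y : C) (i : hom Y X), mono i -> is_zero Y \/ is_iso i.

(* Since morphism spaces are finite dimensional, no object is an infinite
   direct sum of non-zero objects, so only finite families are considered. *)
Definition semisimple (k : fieldType) (C : linear_category k) : Prop :=
  abelian C /\
  forall X : C, exists (n : nat) (S : 'I_n -> C),
    (forall i, simple (S i)) /\ is_direct_sum S X.

Definition indecomposable (k : fieldType) (C : linear_category k) (X : C)
    : Prop :=
  ~ is_zero X /\
  forall Y Z : C, is_direct_sum (fun b : bool => if b then Y else Z) X ->
    is_zero Y \/ is_zero Z.

Record functor (k : fieldType) (C D : linear_category k) := Functor {
  fobj :> C -> D;
  fmap : forall X Y : C, hom X Y -> hom (fobj X) (fobj Y);
  fmap_id : forall X : C, fmap (idm X) = idm (fobj X);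
  fmap_comp : forall (X Y Z : C) (g : hom Y Z) (f : hom X Y),
    fmap (g ∘ f) = fmap g ∘ fmap f
}.

Definition id_functor (k : fieldType) (C : linear_category k) : functor C C :=
  @Functor k C C id (fun _ _ f => f) (fun _ => erefl) (fun _ _ _ _ _ => erefl).

Definition comp_functor (k : fieldType) (C D E : linear_category k)
    (G : functor D E) (F : functor C D) : functor C E :=
  @Functor k C E (fun X => G (F X)) (fun _ _ f => fmap G (fmap F f))
    (fun X => etrans (congr1 (@fmap _ _ _ G _ _) (fmap_id F X)) (fmap_id G (F X)))
    (fun _ _ _ g f => etrans (congr1 (@fmap _ _ _ G _ _) (fmap_comp F g f))
                             (fmap_comp G (fmap F g) (fmap F f))).

Definition naturally_isomorphic (k : fieldType) (C D : linear_category k)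
    (F G : functor C D) : Prop :=
  exists eta : forall X : C, iso (F X) (G X),
    forall (X Y : C) (f : hom X Y), eta Y ∘ fmap F f = fmap G f ∘ eta X.

Definition is_equivalence (k : fieldType) (C D : linear_category k)
    (F : functor C D) : Prop :=
  exists G : functor D C,
    naturally_isomorphic (comp_functor G F) (id_functor C) /\
    naturally_isomorphic (comp_functor F G) (id_functor D).

Definition op (k : fieldType) (C : linear_category k) : linear_category k :=
  @LinearCategory k C (fun X Y => hom Y X) (fun X => idm X)
    (fun _ _ _ g f => f ∘ g)
    (fun _ _ f => comp_idr f) (fun _ _ f => comp_idl f)
    (fun _ _ _ _ h g f => esym (compA f g h))
    (fun _ _ _ f => comp_linearr f) (fun _ _ _ g => comp_linearl g).

Reserved Notation "X ⊗ Y" (at level 39, left associativity).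
Reserved Notation "f ⊠ g" (at level 39, left associativity).

(* [X ⊗ Y] is the tensor product of objects, [f ⊠ g] that of morphisms. *)
Record monoidal_category (k : fieldType) := MonoidalCategory {
  mcat :> linear_category k;
  unit_obj : mcat;
  tens : mcat -> mcat -> mcat where "X ⊗ Y" := (tens X Y);
  tensm : forall X X' Y Y' : mcat,
    hom X X' -> hom Y Y' -> hom (X ⊗ Y) (X' ⊗ Y') where "f ⊠ g" := (tensm f g);
  tensm_id : forall X Y : mcat, idm X ⊠ idm Y = idm (X ⊗ Y);
  tensm_comp : forall (X X' X'' Y Y' Y'' : mcat)
      (f' : hom X' X'') (f : hom X X') (g' : hom Y' Y'') (g : hom Y Y'),
    (f' ∘ f) ⊠ (g' ∘ g) = (f' ⊠ g') ∘ (f ⊠ g);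
  tensm_linearl : forall (X X' Y Y' : mcat) (g : hom Y Y'),
    linear (fun f : hom X X' => f ⊠ g);
  tensm_linearr : forall (X X' Y Y' : mcat) (f : hom X X'),
    linear (fun g : hom Y Y' => f ⊠ g);
  assoc : forall X Y Z : mcat, iso ((X ⊗ Y) ⊗ Z) (X ⊗ (Y ⊗ Z));
  assoc_natural : forall (X X' Y Y' Z Z' : mcat)
      (f : hom X X') (g : hom Y Y') (h : hom Z Z'),
    assoc X' Y' Z' ∘ ((f ⊠ g) ⊠ h) = (f ⊠ (g ⊠ h)) ∘ assoc X Y Z;
  lunit : forall X : mcat, iso (unit_obj ⊗ X) X;
  lunit_natural : forall (X Y : mcat) (f : hom X Y),
    lunit Y ∘ (idm unit_obj ⊠ f) = f ∘ lunit X;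
  runit : forall X : mcat, iso (X ⊗ unit_obj) X;
  runit_natural : forall (X Y : mcat) (f : hom X Y),
    runit Y ∘ (f ⊠ idm unit_obj) = f ∘ runit X;
  pentagon : forall W X Y Z : mcat,
    assoc W X (Y ⊗ Z) ∘ assoc (W ⊗ X) Y Z =
    (idm W ⊠ assoc X Y Z) ∘ assoc W (X ⊗ Y) Z ∘ (assoc W X Y ⊠ idm Z);
  triangle : forall X Y : mcat,
    (idm X ⊠ lunit Y) ∘ assoc X unit_obj Y = runit X ⊠ idm Y
}.

Arguments unit_obj {k} m.
Arguments tens {k m} X Y.
Arguments tensm {k m X X' Y Y'} f g.
Arguments assoc {k m} X Y Z.
Arguments lunit {k m} X.
Arguments runit {k m} X.

Notation "X ⊗ Y" := (tens X Y) : cat_scope.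
Notation "f ⊠ g" := (tensm f g) : cat_scope.

Record braided_category (k : fieldType) := BraidedCategory {
  bcat :> monoidal_category k;
  braid : forall X Y : bcat, iso (X ⊗ Y) (Y ⊗ X);
  braid_natural : forall (X X' Y Y' : bcat) (f : hom X X') (g : hom Y Y'),
    braid X' Y' ∘ (f ⊠ g) = (g ⊠ f) ∘ braid X Y;
  hexagon : forall X Y Z : bcat,
    assoc Y Z X ∘ braid X (Y ⊗ Z) ∘ assoc X Y Z =
    (idm Y ⊠ braid X Z) ∘ assoc Y X Z ∘ (braid X Y ⊠ idm Z);
  hexagon_inv : forall X Y Z : bcat,
    bwd (assoc Z X Y) ∘ braid (X ⊗ Y) Z ∘ bwd (assoc X Y Z) =
    (braid X Z ⊠ idm Y) ∘ bwd (assoc X Z Y) ∘ (idm X ⊠ braid Y Z)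
}.

Definition end_unit_trivial (k : fieldType) (C : monoidal_category k) : Prop :=
  bijective (fun a : k => a *: idm (unit_obj C)).

(* A representation of the functor Z |-> Hom (Z ⊗ X, 1). Linearity of
   [curry Z] is automatic from naturality and bilinearity of ⊗. *)
Record dual_object (k : fieldType) (C : monoidal_category k) (X : C) :=
  DualObject {
  dobj :> C;
  curry : forall Z : C, hom (Z ⊗ X) (unit_obj C) -> hom Z dobj;
  uncurry : forall Z : C, hom Z dobj -> hom (Z ⊗ X) (unit_obj C);
  curryK : forall Z : C, cancel (@curry Z) (@uncurry Z);
  uncurryK : forall Z : C, cancel (@uncurry Z) (@curry Z);
  curry_natural : forall (W Z : C) (g : hom W Z) (f : hom (Z ⊗ X) (unit_obj C)),
    curry (f ∘ (g ⊠ idm X)) = curry f ∘ g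
}.

Lemma uncurry_natural (k : fieldType) (C : monoidal_category k) (X : C)
    (D : dual_object X) (W Z : C) (g : hom W Z) (h : hom Z D) :
  uncurry (h ∘ g) = uncurry h ∘ (g ⊠ idm X).
Proof.
by apply: (can_inj (@curryK _ _ _ D W)); rewrite uncurryK curry_natural uncurryK.
Qed.

(* The morphism f^* : Y^* -> X^* corresponding under the representations to
   the natural transformation Hom (- ⊗ Y, 1) -> Hom (- ⊗ X, 1) given by f. *)
Definition dual_map (k : fieldType) (C : monoidal_category k) (X Y : C)
    (DX : dual_object X) (DY : dual_object Y) (f : hom X Y) : hom DY DX :=
  curry DX (uncurry (idm DY) ∘ (idm DY ⊠ f)).

Lemma dual_map_id (k : fieldType) (C : monoidal_category k) (X : C)
    (D : dual_object X) : dual_map D D (idm X) = idm D.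
Proof. by rewrite /dual_map tensm_id comp_idr uncurryK. Qed.

Lemma dual_map_comp (k : fieldType) (C : monoidal_category k) (X Y Z : C)
    (DX : dual_object X) (DY : dual_object Y) (DZ : dual_object Z)
    (g : hom Y Z) (f : hom X Y) :
  dual_map DX DZ (g ∘ f) = dual_map DX DY f ∘ dual_map DY DZ g.
Proof.
rewrite [dual_map DX DY f]/dual_map -curry_natural; congr (curry _ _).
set h := dual_map DY DZ g.
have -> : uncurry (idm DY) ∘ (idm DY ⊠ f) ∘ (h ⊠ idm X)
        = uncurry (idm DY) ∘ (h ⊠ idm Y) ∘ (idm DZ ⊠ f).
  by rewrite -!compA -!tensm_comp !comp_idl !comp_idr.
rewrite -uncurry_natural comp_idl /h /dual_map curryK -compA -tensm_comp.
by rewrite comp_idl.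
Qed.

(* The target is C^mop: as only the underlying category enters the notion of
   equivalence, the reversed tensor product plays no role. *)
Definition dual_functor (k : fieldType) (C : monoidal_category k)
    (D : forall X : C, dual_object X) : functor C (op C) :=
  @Functor k C (op C) (fun X => D X) (fun X Y f => dual_map (D X) (D Y) f)
    (fun X => dual_map_id (D X))
    (fun X Y Z g f => dual_map_comp (D X) (D Y) (D Z) g f).

Definition r_category (k : fieldType) (C : monoidal_category k) : Prop :=
  exists D : forall X : C, dual_object X, is_equivalence (dual_functor D).

Fixpoint tens_pow (k : fieldType) (C : monoidal_category k) (X : C) (n : nat)
    : C :=
  if n is m.+1 then tens_pow X m ⊗ X else unit_obj C.

Definition object_moderate_growth (k : fieldType) (C : monoidal_category k)
    (X : C) : Prop :=
  exists n : nat, (\dim {: hom (tens_pow X n) (tens_pow X n)} < n`!)%N.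

Definition moderate_growth (k : fieldType) (C : monoidal_category k) : Prop :=
  forall X : C, indecomposable X -> object_moderate_growth X.

(* [Y] is left dual to [X] (equivalently [X] is right dual to [Y]). *)
Definition is_left_dual (k : fieldType) (C : monoidal_category k) (X Y : C)
    : Prop :=
  exists (ev : hom (Y ⊗ X) (unit_obj C)) (coev : hom (unit_obj C) (X ⊗ Y)),
    runit X ∘ (idm X ⊠ ev) ∘ assoc X Y X ∘ (coev ⊠ idm X) = lunit X /\
    lunit Y ∘ (ev ⊠ idm Y) ∘ bwd (assoc Y X Y) ∘ (idm Y ⊠ coev) = runit Y.

Definition rigid_object (k : fieldType) (C : monoidal_category k) (X : C)
    : Prop :=
  (exists Y : C, is_left_dual X Y) /\ (exists Y : C, is_left_dual Y X).

Definition rigid (k : fieldType) (C : monoidal_category k) : Prop :=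
  forall X : C, rigid_object X.

(* Main.v *)
From HB Require Import structures.
From mathcomp Require Import all_boot all_order all_algebra.
Require Import Defs.

(** The idea is that an object of moderate growth cannot have a degenerate
    duality pairing with its representing object.

    Let [X] be simple, with representing object [D] and universal pairing
    [ev D : D ⊗ X -> 1].  The pairing is nonzero, so it splits by semisimplicity
    ([unit_quotient_split]), and moving the section through the braiding gives
    [c : 1 -> X ⊗ D] whose closure with [ev D] and the braiding is the scalar 1.
    The zigzag of [c] and [ev D] is an endomorphism of [X], hence zero or
    invertible.  If it is invertible, correcting [c] by its inverse gives one
    zigzag identity, and universality of [ev D] gives the other
    ([left_dual_of_zigzag]).

    Suppose that the zigzag is zero.  Closing the last strand with [c] and
    [ev D] defines a partial trace from End(A ⊗ X) to End(A).  It sends the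
    identity to the identity because the loop is 1, and it sends the crossing
    of the last two strands to the zigzag ([ptrace_swap]), that is, to 0.
    Moving each of the [n + 1] strands of X^(n+1) to the last place gives
    [n + 1] braids, and the partial traces of their quotients form a
    unitriangular matrix ([ptrace_strand_ratio]).  Hence End(X^(n+1)) contains
    [n + 1] independent copies of End(X^n), and by induction
    dim End(X^n) >= n! for every [n] ([dim_tens_pow_ge]), which contradicts
    moderate growth.

    A general object is a direct sum of simple ones, and coevaluations add up
    ([zigzag_direct_sum]); thus every representing object is a left dual.  Right
    duals come from essential surjectivity of the duality functor, since every
    object is, up to isomorphism, a representing object. *)

Set Implicit Arguments.
Unset Strict Implicit.
Unset Printing Implicit Defensive.

Import GRing.Theory.
Local Open Scope ring_scope.
Local Open Scope cat_scope.

Local Notation "f ▷ U" := (f ⊠ idm U) (at level 39, left associativity).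
Local Notation "A ◁ f" := (idm A ⊠ f) (at level 38, right associativity).

(** * Composition in linear categories *)

Section LinearCategory.

Variables (k : fieldType) (C : linear_category k).
Implicit Types X Y Z W : C.

Lemma comp_0l X Y Z (f : hom X Y) : (0 : hom Y Z) ∘ f = 0.
Proof.
have := comp_linearl f 1 (0 : hom Y Z) 0.
by rewrite !scale1r addr0 => /esym; rewrite -[RHS]addr0 => /addrI.
Qed.

Lemma comp_0r X Y Z (g : hom Y Z) : g ∘ (0 : hom X Y) = 0.
Proof.
have := comp_linearr g 1 (0 : hom X Y) 0.
by rewrite !scale1r addr0 => /esym; rewrite -[RHS]addr0 => /addrI.
Qed.

Lemma compDl X Y Z (g g' : hom Y Z) (f : hom X Y) :
  (g + g') ∘ f = g ∘ f + g' ∘ f.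
Proof. by have := comp_linearl f 1 g g'; rewrite !scale1r. Qed.

Lemma compDr X Y Z (g : hom Y Z) (f f' : hom X Y) :
  g ∘ (f + f') = g ∘ f + g ∘ f'.
Proof. by have := comp_linearr g 1 f f'; rewrite !scale1r. Qed.

Lemma compZl X Y Z a (g : hom Y Z) (f : hom X Y) : (a *: g) ∘ f = a *: (g ∘ f).
Proof. by have := comp_linearl f a g 0; rewrite !addr0 comp_0l addr0. Qed.

Lemma compZr X Y Z a (g : hom Y Z) (f : hom X Y) : g ∘ (a *: f) = a *: (g ∘ f).
Proof. by have := comp_linearr g a f 0; rewrite !addr0 comp_0r addr0. Qed.

Lemma comp_suml X Y Z I (r : seq I) (P : pred I) (g : I -> hom Y Z)
    (f : hom X Y) :
  (\sum_(i <- r | P i) g i) ∘ f = \sum_(i <- r | P i) g i ∘ f.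
Proof.
exact: (big_morph (fun g => g ∘ f) (fun g g' => compDl g g' f) (comp_0l _ f)).
Qed.

Lemma comp_sumr X Y Z I (r : seq I) (P : pred I) (g : hom Y Z)
    (f : I -> hom X Y) :
  g ∘ (\sum_(i <- r | P i) f i) = \sum_(i <- r | P i) g ∘ f i.
Proof. exact: (big_morph (fun f => g ∘ f) (compDr g) (comp_0r _ g)). Qed.

Lemma fwd_inj X Y Z (i : iso X Y) (f g : hom Z X) : i ∘ f = i ∘ g -> f = g.
Proof.
by move=> e; rewrite -[f]comp_idl -[g]comp_idl -(bwdK i) -!compA e.
Qed.

Lemma fwd_surj X Y Z (i : iso X Y) (f g : hom Y Z) : f ∘ i = g ∘ i -> f = g.
Proof.
by move=> e; rewrite -[f]comp_idr -[g]comp_idr -(fwdK i) !compA e.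
Qed.

Lemma bwd_eql X Y Z (i : iso X Y) (f : hom Z Y) (g : hom Z X) :
  f = i ∘ g -> bwd i ∘ f = g.
Proof. by move=> ->; rewrite compA bwdK comp_idl. Qed.

Lemma bwd_eqr X Y Z (i : iso X Y) (f : hom X Z) (g : hom Y Z) :
  f = g ∘ i -> f ∘ bwd i = g.
Proof. by move=> ->; rewrite -compA fwdK comp_idr. Qed.

Definition iso_id X : iso X X := Iso (comp_idl (idm X)) (comp_idl (idm X)).

Definition iso_comp X Y Z (j : iso Y Z) (i : iso X Y) : iso X Z.
Proof.
apply: (@Iso _ _ _ _ (j ∘ i) (bwd i ∘ bwd j)).
- by rewrite compA -(compA _ (bwd j)) bwdK comp_idr bwdK.
- by rewrite compA -(compA _ i) fwdK comp_idr fwdK.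
Defined.

End LinearCategory.

(** * Coherence for unitors *)

Section Monoidal.

Variables (k : fieldType) (C : monoidal_category k).
Notation "𝟙" := (unit_obj C).
Implicit Types A B U V W X Y Z : C.

Lemma whiskr_comp U X Y Z (g : hom Y Z) (f : hom X Y) :
  (g ∘ f) ▷ U = (g ▷ U) ∘ (f ▷ U).
Proof. by rewrite -tensm_comp comp_idl. Qed.

Lemma whiskl_comp U X Y Z (g : hom Y Z) (f : hom X Y) :
  U ◁ (g ∘ f) = (U ◁ g) ∘ (U ◁ f).
Proof. by rewrite -tensm_comp comp_idl. Qed.

Lemma whisk_exchange X X' Y Y' (f : hom X X') (g : hom Y Y') :
  (f ▷ Y') ∘ (X ◁ g) = (X' ◁ g) ∘ (f ▷ Y).
Proof. by rewrite -!tensm_comp !comp_idl !comp_idr. Qed.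

Lemma whiskr0 U X Y : (0 : hom X Y) ▷ U = 0.
Proof.
have := tensm_linearl (idm U) 1 (0 : hom X Y) 0.
by rewrite !scale1r addr0 => /esym; rewrite -[RHS]addr0 => /addrI.
Qed.

Lemma whiskl0 U X Y : U ◁ (0 : hom X Y) = 0.
Proof.
have := tensm_linearr (idm U) 1 (0 : hom X Y) 0.
by rewrite !scale1r addr0 => /esym; rewrite -[RHS]addr0 => /addrI.
Qed.

Lemma whiskrD U X Y (f g : hom X Y) : (f + g) ▷ U = f ▷ U + g ▷ U.
Proof. by have := tensm_linearl (idm U) 1 f g; rewrite !scale1r. Qed.

Lemma whiskr_sum U X Y I (r : seq I) (P : pred I) (f : I -> hom X Y) :
  (\sum_(i <- r | P i) f i) ▷ U = \sum_(i <- r | P i) f i ▷ U.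
Proof.
exact: (big_morph (fun g : hom X Y => g ▷ U) (@whiskrD U X Y) (@whiskr0 U X Y)).
Qed.

Lemma whiskr1_inj X Y (f g : hom X Y) : f ▷ 𝟙 = g ▷ 𝟙 -> f = g.
Proof.
by move=> e; apply: (@fwd_surj _ _ _ _ _ (runit X)); rewrite -!runit_natural e.
Qed.

Lemma whiskl1_inj X Y (f g : hom X Y) : 𝟙 ◁ f = 𝟙 ◁ g -> f = g.
Proof.
by move=> e; apply: (@fwd_surj _ _ _ _ _ (lunit X)); rewrite -!lunit_natural e.
Qed.

Definition whiskr_iso X Y (i : iso X Y) U : iso (X ⊗ U) (Y ⊗ U).
Proof.
by apply: (@Iso _ _ _ _ (fwd i ▷ U) (bwd i ▷ U));
  rewrite -whiskr_comp ?bwdK ?fwdK tensm_id.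
Defined.

Lemma assoc_naturall A A' U V (f : hom A A') :
  assoc A' U V ∘ (f ▷ U ▷ V) = (f ▷ (U ⊗ V)) ∘ assoc A U V.
Proof. by rewrite assoc_natural tensm_id. Qed.

Lemma assoc_naturalm A U U' V (f : hom U U') :
  assoc A U' V ∘ ((A ◁ f) ▷ V) = (A ◁ (f ▷ V)) ∘ assoc A U V.
Proof. exact: assoc_natural. Qed.

Lemma assoc_naturalr A U V V' (f : hom V V') :
  assoc A U V' ∘ ((A ⊗ U) ◁ f) = (A ◁ (U ◁ f)) ∘ assoc A U V.
Proof. by rewrite -assoc_natural tensm_id. Qed.

(** The next three identities are Kelly's consequences of the pentagon and the
    triangle.  Tensoring with the unit is faithful, and after that operation
    this one and the next follow from a pentagon with two unit factors. *)
Lemma lunit_tens X Y : lunit (X ⊗ Y) ∘ assoc 𝟙 X Y = lunit X ▷ Y.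
Proof.
apply: whiskl1_inj; apply: (@fwd_surj _ _ _ _ _ (assoc 𝟙 (𝟙 ⊗ X) Y)).
apply: (@fwd_surj _ _ _ _ _ (whiskr_iso (assoc 𝟙 𝟙 X) Y)) => /=.
rewrite whiskl_comp -assoc_naturalm -(compA (assoc _ _ _)) -whiskr_comp triangle.
rewrite assoc_naturall -triangle -!compA; congr (_ ∘ _).
by rewrite pentagon -!compA.
Qed.

Lemma runit_tens A B : (A ◁ runit B) ∘ assoc A B 𝟙 = runit (A ⊗ B).
Proof.
apply: whiskr1_inj; apply: (@fwd_inj _ _ _ _ _ (assoc A B 𝟙)).
rewrite whiskr_comp compA assoc_naturalm -[_ ▷ 𝟙]triangle whiskl_comp.
rewrite -!compA [X in _ ∘ X]compA -pentagon compA -assoc_naturalr -!compA.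
by rewrite triangle.
Qed.

Lemma lunit1_runit1 : fwd (lunit 𝟙) = fwd (runit 𝟙).
Proof.
apply: whiskr1_inj; rewrite -lunit_tens -triangle; congr (_ ∘ _).
by apply: (@fwd_inj _ _ _ _ _ (lunit 𝟙)); rewrite lunit_natural.
Qed.

(** * Cups, caps and zigzags *)

Section Zigzag.

Variables X Y : C.
Implicit Types (c : hom 𝟙 (X ⊗ Y)) (e : hom (Y ⊗ X) 𝟙).

(** Cups, caps and braidings are all used with an arbitrary factor [A] on their
    left, that is, as natural transformations between composites of the
    functors [- ⊗ X] and [- ⊗ Y].  Composites of functors are strictly
    associative, and [tens_pow X n] is literally the [n]-th iterate of [- ⊗ X]
    at the unit, so after the identities below no associator is left. *)
Definition cup c A : hom A ((A ⊗ X) ⊗ Y) :=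
  bwd (assoc A X Y) ∘ (A ◁ c) ∘ bwd (runit A).

Definition cap e A : hom ((A ⊗ Y) ⊗ X) A := runit A ∘ (A ◁ e) ∘ assoc A Y X.

Definition zigzag c e A : hom (A ⊗ X) (A ⊗ X) := cap e (A ⊗ X) ∘ (cup c A ▷ X).

Lemma cap_natural e A B (f : hom A B) : cap e B ∘ (f ▷ Y ▷ X) = f ∘ cap e A.
Proof.
rewrite /cap -compA assoc_naturall compA -(compA (runit B)) -whisk_exchange.
by rewrite compA runit_natural -!compA.
Qed.

Lemma bwd_runit_natural A B (f : hom A B) :
  bwd (runit B) ∘ f = (f ▷ 𝟙) ∘ bwd (runit A).
Proof. by apply: bwd_eql; rewrite compA runit_natural -compA fwdK comp_idr. Qed.

Lemma bwd_assoc_naturall A A' U V (f : hom A A') :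
  bwd (assoc A' U V) ∘ (f ▷ (U ⊗ V)) = (f ▷ U ▷ V) ∘ bwd (assoc A U V).
Proof. by apply: bwd_eql; rewrite compA assoc_naturall -compA fwdK comp_idr. Qed.

Lemma cup_natural c A B (f : hom A B) : cup c B ∘ f = (f ▷ X ▷ Y) ∘ cup c A.
Proof.
rewrite /cup -compA bwd_runit_natural compA -(compA (bwd _)) -whisk_exchange.
by rewrite compA bwd_assoc_naturall -!compA.
Qed.

(** Together with the analogue for cups, the reason why a zigzag shifted by [A]
    carries no more information than the zigzag itself. *)
Lemma cap_tens e A B :
  (A ◁ cap e B) ∘ assoc A (B ⊗ Y) X ∘ (assoc A B Y ▷ X) = cap e (A ⊗ B).
Proof.
rewrite /cap !whiskl_comp -runit_tens -!compA; congr (_ ∘ _).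
by rewrite [X in _ ∘ X]compA -pentagon !compA assoc_naturalr.
Qed.

Lemma cup_tens c A B :
  assoc A (B ⊗ X) Y ∘ (assoc A B X ▷ Y) ∘ cup c (A ⊗ B) = A ◁ cup c B.
Proof.
rewrite /cup -!(compA (bwd _)) whiskl_comp.
have -> : A ◁ bwd (assoc B X Y) =
    assoc A (B ⊗ X) Y ∘ (assoc A B X ▷ Y) ∘ bwd (assoc (A ⊗ B) X Y) ∘
    bwd (assoc A B (X ⊗ Y)).
  apply/esym/bwd_eqr/bwd_eqr; rewrite -compA pentagon !compA -whiskl_comp.
  by rewrite bwdK tensm_id comp_idl.
rewrite -!compA; do 3 congr (_ ∘ _).
apply/esym/bwd_eql; rewrite compA assoc_naturalr !whiskl_comp -compA.
congr (_ ∘ _); apply/esym/bwd_eqr; rewrite -runit_tens compA -whiskl_comp.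
by rewrite bwdK tensm_id comp_idl.
Qed.

Lemma zigzag_natural c e A B (f : hom A B) :
  zigzag c e B ∘ (f ▷ X) = (f ▷ X) ∘ zigzag c e A.
Proof.
rewrite /zigzag -compA -whiskr_comp cup_natural whiskr_comp compA.
by rewrite cap_natural !compA.
Qed.

Lemma zigzag_tens c e A B :
  assoc A B X ∘ zigzag c e (A ⊗ B) = (A ◁ zigzag c e B) ∘ assoc A B X.
Proof.
rewrite /zigzag compA -cap_natural -cap_tens -!compA -!whiskr_comp.
by rewrite (compA _ _ (cup _ _)) cup_tens assoc_naturalm !compA -whiskl_comp.
Qed.

Lemma cup_unit c : (lunit X ▷ Y) ∘ cup c 𝟙 = c.
Proof.
rewrite /cup -lunit_tens !compA -(compA (lunit _)) fwdK comp_idr.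
by rewrite lunit_natural lunit1_runit1 -compA fwdK comp_idr.
Qed.

Lemma cap_unit e : cap e 𝟙 = e ∘ (lunit Y ▷ X).
Proof. by rewrite -lunit_tens compA -lunit_natural lunit1_runit1. Qed.

Lemma zigzag_unit c e : lunit X ∘ zigzag c e 𝟙 = cap e X ∘ (c ▷ X).
Proof. by rewrite /zigzag compA -cap_natural -compA -whiskr_comp cup_unit. Qed.

Lemma zigzag_id c e A : cap e X ∘ (c ▷ X) = lunit X -> zigzag c e A = idm (A ⊗ X).
Proof.
move=> h; have z1 : zigzag c e 𝟙 = idm _.
  by apply: (@fwd_inj _ _ _ _ _ (lunit X)); rewrite zigzag_unit h comp_idr.
apply: (@fwd_surj _ _ _ _ _ (whiskr_iso (runit A) X)) => /=.
rewrite zigzag_natural comp_idl -[RHS]comp_idr; congr (_ ∘ _).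
apply: (@fwd_inj _ _ _ _ _ (assoc A 𝟙 X)).
by rewrite zigzag_tens z1 tensm_id comp_idl comp_idr.
Qed.

Lemma zigzag_0 c e A : cap e X ∘ (c ▷ X) = 0 -> zigzag c e A = 0.
Proof.
move=> h; have z1 : zigzag c e 𝟙 = 0.
  by apply: (@fwd_inj _ _ _ _ _ (lunit X)); rewrite zigzag_unit h comp_0r.
apply: (@fwd_surj _ _ _ _ _ (whiskr_iso (runit A) X)) => /=.
rewrite zigzag_natural comp_0l -[RHS](comp_0r _ (runit A ▷ X)); congr (_ ∘ _).
apply: (@fwd_inj _ _ _ _ _ (assoc A 𝟙 X)).
by rewrite zigzag_tens z1 whiskl0 comp_0l comp_0r.
Qed.

Lemma cap_snake c e A :
  cap e A ∘ (((cap e A ▷ Y) ∘ cup c (A ⊗ Y)) ▷ X) = cap e A ∘ zigzag c e (A ⊗ Y).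
Proof. by rewrite /zigzag whiskr_comp [LHS]compA cap_natural -compA. Qed.

(** One zigzag identity makes the endomorphism of [Y] in the other one invisible
    to [e].  When [e] is a universal pairing, that endomorphism is therefore the
    identity, and only one zigzag identity has to be established. *)
Lemma second_zigzag c e : cap e X ∘ (c ▷ X) = lunit X ->
  e ∘ ((lunit Y ∘ (e ▷ Y) ∘ cup c Y) ▷ X) = e.
Proof.
move=> h; apply: (@fwd_surj _ _ _ _ _ (whiskr_iso (lunit Y) X)) => /=.
rewrite -[RHS]cap_unit -compA -whiskr_comp -(compA _ (cup c Y)) cup_natural.
rewrite -(compA (lunit Y) (e ▷ Y)) (compA (e ▷ Y)) -(whiskr_comp Y) -cap_unit.
rewrite (whiskr_comp X (lunit Y)) compA -cap_unit cap_snake.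
by rewrite zigzag_id // comp_idr.
Qed.

End Zigzag.

End Monoidal.

(** * The braiding of the last two factors *)

Section Braided.

Variables (k : fieldType) (C : braided_category k).
Notation "𝟙" := (unit_obj C).
Implicit Types A B U V W X Y Z : C.

(** The braiding conjugated by the associator, specified by the one equation
    through which it is used. *)
Lemma swap_subproof A U V : {s : iso ((A ⊗ U) ⊗ V) ((A ⊗ V) ⊗ U) |
  assoc A V U ∘ s = (A ◁ braid U V) ∘ assoc A U V}.
Proof.
unshelve eexists; first apply: (@Iso _ _ _ _
  (bwd (assoc A V U) ∘ (A ◁ braid U V) ∘ assoc A U V)
  (bwd (assoc A U V) ∘ (A ◁ bwd (braid U V)) ∘ assoc A V U)).
- rewrite -!compA; apply: bwd_eql; rewrite comp_idr (compA (assoc A V U)) fwdK.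
  by rewrite comp_idl compA -whiskl_comp bwdK tensm_id comp_idl.
- rewrite -!compA; apply: bwd_eql; rewrite comp_idr (compA (assoc A U V)) fwdK.
  by rewrite comp_idl compA -whiskl_comp fwdK tensm_id comp_idl.
- by rewrite /= !compA fwdK comp_idl.
Qed.

Definition swap A U V := sval (swap_subproof A U V).

Lemma assoc_swap A U V : assoc A V U ∘ swap A U V = (A ◁ braid U V) ∘ assoc A U V.
Proof. exact: svalP (swap_subproof A U V). Qed.

Lemma swap_natural A A' U U' V V' (f : hom A A') (u : hom U U') (v : hom V V') :
  swap A' U' V' ∘ ((f ⊠ u) ⊠ v) = ((f ⊠ v) ⊠ u) ∘ swap A U V.
Proof.
apply: (@fwd_inj _ _ _ _ _ (assoc A' V' U')).
rewrite !compA assoc_swap assoc_natural -!compA assoc_swap assoc_natural.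
by rewrite !compA -!tensm_comp braid_natural comp_idl comp_idr.
Qed.

Lemma swap_naturalr A U V V' (v : hom V V') :
  swap A U V' ∘ ((A ⊗ U) ◁ v) = ((A ◁ v) ▷ U) ∘ swap A U V.
Proof. by rewrite -tensm_id swap_natural. Qed.

(** With the left factor present, the hexagon says that moving [U] past [V] and
    then past [W] is moving it past [V ⊗ W]: the associators inside the hexagon
    are absorbed by two pentagons. *)
Lemma swap_hexagon A U V W :
  (assoc A V W ▷ U) ∘ swap (A ⊗ V) U W ∘ (swap A U V ▷ W) =
  swap A U (V ⊗ W) ∘ assoc (A ⊗ U) V W.
Proof.
apply: (@fwd_inj _ _ _ _ _ (assoc A (V ⊗ W) U)).
rewrite [RHS]compA assoc_swap -[RHS]compA pentagon.
have a_inj f g : (A ◁ assoc V W U) ∘ f = (A ◁ assoc V W U) ∘ g -> f = g.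
  move=> /(congr1 (comp (A ◁ bwd (assoc V W U)))).
  by rewrite !compA -!whiskl_comp bwdK tensm_id !comp_idl.
apply: a_inj.
rewrite !compA -pentagon -!whiskl_comp hexagon !whiskl_comp.
rewrite -(compA _ (assoc (A ⊗ V) W U)) assoc_swap compA assoc_naturalr.
rewrite -(compA _ (assoc A V (U ⊗ W))) pentagon -!compA; do 2 congr (_ ∘ _).
rewrite -whiskr_comp assoc_swap whiskr_comp !compA; congr (_ ∘ _).
by rewrite assoc_naturalm.
Qed.

(** Naturality of the passage of [U] past [V ⊗ W] with respect to the braiding
    of [V] with [W]. *)
Lemma swap_yang_baxter A U V W :
  swap (A ⊗ W) U V ∘ (swap A U W ▷ V) ∘ swap (A ⊗ U) V W =
  (swap A V W ▷ U) ∘ swap (A ⊗ V) U W ∘ (swap A U V ▷ W).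
Proof.
apply: (@fwd_inj _ _ _ _ _ (whiskr_iso (assoc A W V) U)) => /=.
rewrite !compA swap_hexagon -compA assoc_swap compA.
rewrite swap_naturalr -compA -swap_hexagon !compA -[in RHS]whiskr_comp assoc_swap.
by rewrite whiskr_comp.
Qed.

(** Passing the unit twice is passing [𝟙 ⊗ 𝟙], which is passing it once; since
    the passage is invertible, it is trivial. *)
Lemma swap_unit A U : (runit A ▷ U) ∘ swap A U 𝟙 = runit (A ⊗ U).
Proof.
apply: whiskr1_inj; apply: (@fwd_inj _ _ _ _ _ (swap A U 𝟙)).
rewrite whiskr_comp compA swap_natural.
rewrite -[_ ▷ 𝟙 in RHS]triangle [RHS]compA swap_naturalr.
rewrite -[RHS]compA -swap_hexagon [RHS]compA [X in _ = X ∘ _]compA.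
by rewrite -[in RHS]whiskr_comp triangle.
Qed.

(** A strand [U] that passes over both ends of a cup can be pulled off it. *)
Lemma swap_cup U X Y (c : hom 𝟙 (X ⊗ Y)) A :
  swap (A ⊗ X) U Y ∘ (swap A U X ▷ Y) ∘ cup c (A ⊗ U) = cup c A ▷ U.
Proof.
apply: (@fwd_inj _ _ _ _ _ (whiskr_iso (assoc A X Y) U)) => /=.
rewrite !compA swap_hexagon /cup -whiskr_comp !compA fwdK comp_idl.
rewrite -(compA _ (assoc _ _ _)) fwdK comp_idr.
apply: bwd_eqr; rewrite swap_naturalr whiskr_comp -compA; congr (_ ∘ _).
by rewrite -swap_unit compA -whiskr_comp bwdK tensm_id comp_idl.
Qed.

(** * The partial trace over the last factor *)

Section PartialTrace.

Variables (X Y : C) (c : hom 𝟙 (X ⊗ Y)) (e : hom (Y ⊗ X) 𝟙).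

(** The last strand is closed up by [c] and by the pairing [e ∘ braid X Y].
    The duality between [X] and [Y] that a genuine partial trace requires is
    replaced by any two such morphisms. *)
Definition ptrace A B (m : hom (A ⊗ X) (B ⊗ X)) : hom A B :=
  cap e B ∘ swap B X Y ∘ (m ▷ Y) ∘ cup c A.

Lemma ptrace_bimodule A A' B B' (b : hom B B') (m : hom (A ⊗ X) (B ⊗ X))
    (a : hom A' A) :
  ptrace ((b ▷ X) ∘ m ∘ (a ▷ X)) = b ∘ ptrace m ∘ a.
Proof.
have E : cap e B' ∘ swap B' X Y ∘ (b ▷ X ▷ Y) = b ∘ (cap e B ∘ swap B X Y).
  by rewrite -compA swap_natural compA cap_natural compA.
rewrite /ptrace !whiskr_comp -(compA b) -(compA _ (cup c A)) cup_natural.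
by move: (cap e B) (cap e B') (cup c A') E => p p' u E; rewrite !compA E !compA.
Qed.

Lemma ptrace_postcomp A B B' (b : hom B B') (m : hom (A ⊗ X) (B ⊗ X)) :
  ptrace ((b ▷ X) ∘ m) = b ∘ ptrace m.
Proof.
by have := ptrace_bimodule b m (idm A); rewrite tensm_id !comp_idr.
Qed.

Lemma ptrace_0 A B : ptrace (0 : hom (A ⊗ X) (B ⊗ X)) = 0.
Proof. by rewrite /ptrace whiskr0 comp_0r comp_0l. Qed.

Lemma ptrace_sum A B I (r : seq I) (P : pred I) (m : I -> hom (A ⊗ X) (B ⊗ X)) :
  ptrace (\sum_(i <- r | P i) m i) = \sum_(i <- r | P i) ptrace (m i).
Proof. by rewrite /ptrace whiskr_sum comp_sumr comp_suml. Qed.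

Lemma ptrace_id A : e ∘ braid X Y ∘ c = idm 𝟙 -> ptrace (idm (A ⊗ X)) = idm A.
Proof.
move=> h; rewrite /ptrace tensm_id comp_idr /cap /cup.
rewrite -(compA _ (assoc A Y X)) assoc_swap !compA.
rewrite -(compA _ (assoc A X Y)) fwdK comp_idr -2!(compA (runit A)) -!whiskl_comp.
by rewrite h tensm_id comp_idr fwdK.
Qed.

(** Where the zigzag enters: closing up one strand of a crossing and pulling the
    other strand off the cup leaves the zigzag of [c] and [e].  The sign of the
    braiding in the closure is chosen so that the free strand runs over both
    ends of the cup. *)
Lemma ptrace_swap A : ptrace (swap A X X) = zigzag c e A.
Proof. by rewrite /ptrace /zigzag -!compA (compA (swap _ _ _)) swap_cup. Qed.

End PartialTrace.

End Braided.

(** * Factorial growth of tensor powers *)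

Lemma dim_jointly_injective (k : fieldType) (U V : vectType k) n
    (f : 'I_n -> U -> V) :
  (forall i, linear (f i)) ->
  (forall u : 'I_n -> U, \sum_i f i (u i) = 0 -> forall i, u i = 0) ->
  (n * \dim {:U} <= \dim {:V})%N.
Proof.
move=> f_lin f_inj.
pose phi i : {linear U -> V} :=
  HB.pack (f i) (GRing.isLinear.Build k U V _ (f i) (f_lin i)).
have phi0 i : lker (linfun (phi i)) == 0%VS.
  apply/lker0P => u v; rewrite !lfunE /= => e.
  apply/subr0_eq; pose w j := if j == i then u - v else 0.
  have /(_ i) : forall j, w j = 0; last by rewrite /w eqxx.
  apply: f_inj; rewrite (bigD1 i) //= /w eqxx big1 ?addr0 => [|j /negbTE->].
    by have := raddfB (phi i) u v => /= ->; rewrite e subrr.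
  exact: (raddf0 (phi j)).
have dx : directv (\sum_i limg (linfun (phi i))).
  apply/directv_sum_independent => u um u0 i _.
  have /all_sig [w wE] : forall i, {w | u i = f i w}.
    move=> j; apply/sig_eqW; have /memv_imgP [w _ ->] := um j isT.
    by exists w; rewrite lfunE.
  rewrite wE; have -> : w i = 0; last exact: (raddf0 (phi i)).
  by apply: f_inj; rewrite -[RHS]u0; apply: eq_bigr => j _; rewrite wE.
have := dimvS (subvf (\sum_i limg (linfun (phi i)))%VS).
rewrite (directvP dx) /=; under eq_bigr => i _.
  rewrite limg_dim_eq; last by rewrite (eqP (phi0 i)) capv0.
  over.
by rewrite sum_nat_const card_ord.
Qed.

Section Growth.

Variables (k : fieldType) (C : braided_category k).
Variable X : C.
Notation "𝟙" := (unit_obj C).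

(** The braid on [n + 1] strands which brings to the last place the strand that
    lies [j] places before it.  For [j > n] there is no such strand, and the
    value has no meaning. *)
Fixpoint strand n j : iso (tens_pow X n.+1) (tens_pow X n.+1) :=
  match n, j with
  | m.+1, i.+1 =>
    iso_comp (swap (tens_pow X m) X X) (whiskr_iso (strand m i) X)
  | _, _ => iso_id _
  end.

Lemma swap_conj A :
  swap (A ⊗ X) X X ∘ (swap A X X ▷ X) ∘ bwd (swap (A ⊗ X) X X) =
  (bwd (swap A X X) ▷ X) ∘ swap (A ⊗ X) X X ∘ (swap A X X ▷ X).
Proof.
apply: bwd_eqr; rewrite -!compA.
apply: (@fwd_inj _ _ _ _ _ (whiskr_iso (swap A X X) X)).
rewrite /= (compA _ (bwd _ ▷ X)) -whiskr_comp fwdK tensm_id comp_idl.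
by have := swap_yang_baxter A X X X; rewrite !compA => ->.
Qed.

(** The quotient of two such braids, in this order, contains exactly one crossing
    of the last two strands, and that crossing is positive: it lies in the
    double coset of the last generator of the braid group on [n + 2] strands
    with respect to the braid group on the first [n + 1] strands.  In the
    inductive step the Yang-Baxter equation moves a conjugation by the last
    generator into these first [n + 1] strands. *)
Lemma strand_ratio n i j : (i < j <= n.+1)%N ->
  exists a b, strand n.+1 j ∘ bwd (strand n.+1 i) =
              (a ▷ X) ∘ swap (tens_pow X n) X X ∘ (b ▷ X).
Proof.
elim: n i j => [|n IHn] [|i] [|j] //.
- move=> _; exists (idm _), (strand 0 j).
  by rewrite /= tensm_id comp_idl comp_idr.
- by case: j => [|j]; rewrite ?andbF.
- move=> _; exists (idm _), (strand n.+1 j).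
  by rewrite [X in _ ∘ X]/= comp_idr tensm_id comp_idl.
rewrite !ltnS => /IHn [a] [b] abE.
exists ((a ▷ X) ∘ bwd (swap (tens_pow X n) X X)).
exists (swap (tens_pow X n) X X ∘ (b ▷ X)).
rewrite -[LHS]/((swap (tens_pow X n.+1) X X ∘ (strand n.+1 j ▷ X)) ∘
  ((bwd (strand n.+1 i) ▷ X) ∘ bwd (swap (tens_pow X n.+1) X X))).
move: abE; move: (fwd (strand _ _)) (bwd (strand _ _)) => s t abE.
rewrite !compA -(compA _ (s ▷ X)) -whiskr_comp abE !whiskr_comp.
have bN : (b ▷ X ▷ X) ∘ bwd (swap (tens_pow X n.+1) X X) =
    bwd (swap (tens_pow X n.+1) X X) ∘ (b ▷ X ▷ X).
  by apply/esym/bwd_eql; rewrite compA swap_natural -compA fwdK comp_idr.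
rewrite !compA swap_natural -(compA _ _ (bwd _)) bN.
by rewrite -!(compA (a ▷ X ▷ X)) -swap_conj !compA.
Qed.

Section ZeroZigzag.

Variables (Y : C) (c : hom 𝟙 (X ⊗ Y)) (e : hom (Y ⊗ X) 𝟙).
Hypothesis loop1 : e ∘ braid X Y ∘ c = idm 𝟙.
Hypothesis zigzag0 : cap e X ∘ (c ▷ X) = 0.

Lemma ptrace_strand_ratio n i j : (i < j <= n)%N ->
  ptrace c e (strand n j ∘ bwd (strand n i)) = 0.
Proof.
case: n => [|n]; first by rewrite leqn0 => /andP[/[swap]/eqP->].
move=> /strand_ratio [a [b ->]].
by rewrite ptrace_bimodule ptrace_swap zigzag_0 // comp_0r comp_0l.
Qed.

(** The matrix of partial traces of the quotients of the braids is triangular with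
    identities on the diagonal; the entries on the other side of the diagonal,
    which involve inverse crossings, are not controlled. *)
Lemma strands_independent n B (a : 'I_n.+1 -> hom (tens_pow X n) B) :
  \sum_j (a j ▷ X) ∘ strand n j = 0 -> forall j, a j = 0.
Proof.
move=> a0 j; have [m] := ubnP j; elim: m j => // m IHm j ltjm.
(* Coefficients are killed in increasing order of the index, so that only
   quotients covered by the previous lemma remain at each stage. *)
have := congr1 (fun h => ptrace c e (h ∘ bwd (strand n j))) a0.
rewrite comp_0l ptrace_0 comp_suml ptrace_sum (bigD1 j) //= big1.
  by rewrite addr0 -compA fwdK ptrace_postcomp ptrace_id // comp_idr.
move=> i neq_ij; rewrite -compA ptrace_postcomp.
case: (ltngtP i j) neq_ij => [ltij _|ltji _|/val_inj -> /eqP//].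
  by rewrite IHm ?comp_0l // (leq_trans ltij).
by rewrite ptrace_strand_ratio ?comp_0r // ltji -ltnS ltn_ord.
Qed.

(** If the closed loop is [1] and the zigzag vanishes, each additional tensor
    factor multiplies the dimension by at least the new number of strands. *)
Lemma dim_tens_pow_ge n : idm 𝟙 <> 0 ->
  (n`! <= \dim {: hom (tens_pow X n) (tens_pow X n)})%N.
Proof.
move=> id_neq0; elim: n => [|n IHn].
  rewrite fact0 lt0n dimv_eq0; apply/eqP => full0; apply: id_neq0.
  by apply/eqP; rewrite -memv0 -full0 memvf.
rewrite factS; apply: leq_trans (leq_mul (leqnn _) IHn) _.
apply: (dim_jointly_injective (f := fun j a => (a ▷ X) ∘ strand n j)).
  by move=> j x a b; rewrite tensm_linearl compDl -compZl.
exact: strands_independent.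
Qed.

End ZeroZigzag.

End Growth.

(** * Simple objects and maps to the unit *)

Section Simple.

Variables (k : fieldType) (C : linear_category k).
Implicit Types X Y Z : C.

Lemma id0_zero X : idm X = 0 -> is_zero X.
Proof.
move=> h Y; split=> f; first by rewrite -[f]comp_idr h comp_0r.
by rewrite -[f]comp_idl h comp_0l.
Qed.

Lemma simple_id_neq0 X : simple X -> idm X <> 0.
Proof. by case=> nz _ /id0_zero. Qed.

Lemma simple_mono X Y (f : hom X Y) :
  abelian C -> simple X -> f <> 0 -> mono f.
Proof.
case=> _ kernels _ _ _ [_ subobj] f_neq0.
have [K [i [fi0 ker_univ]]] := kernels X Y f.
have i_mono : mono i.
  move=> Z g h gh; have fig0 : f ∘ (i ∘ g) = 0 by rewrite compA fi0 comp_0l.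
  have [u [_ uniq]] := ker_univ _ _ fig0.
  by rewrite -(uniq g) // -(uniq h).
case: (subobj K i i_mono) => [K0|[j [_ ij]]]; last first.
  by case: f_neq0; rewrite -[f]comp_idr -ij compA fi0 comp_0l.
move=> Z g h /eqP; rewrite -subr_eq0 => /eqP fgh; apply/subr0_eq.
have fgh0 : f ∘ (g - h) = 0 by rewrite compDr -scaleN1r compZr scaleN1r.
have [u [<- _]] := ker_univ _ _ fgh0.
by rewrite (proj2 (K0 Z) u) comp_0r.
Qed.

Lemma schur X Y (f : hom X Y) :
  abelian C -> simple X -> simple Y -> f <> 0 -> is_iso f.
Proof.
move=> abC sX [_ subY] /(simple_mono abC sX) /subY[X0|//].
by case: sX => nzX _; case: (nzX X0).
Qed.

Lemma simple_indecomposable X : simple X -> indecomposable X.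
Proof.
case=> nz sub; split=> // Y Z [inj [prj [pi1 pi0 _]]].
have mY : mono (inj true).
  move=> W g h e; rewrite -[g]comp_idl -[h]comp_idl -(pi1 true) -!compA.
  by congr (_ ∘ _).
case: (sub _ _ mY) => [|[j [_ ij]]]; first by left.
right; apply: id0_zero; rewrite -(pi1 false) -[prj false]comp_idr -ij.
by rewrite !compA (pi0 true false) // !comp_0l.
Qed.

End Simple.

Section Unit.

Variables (k : fieldType) (C : monoidal_category k).
Notation "𝟙" := (unit_obj C).

Lemma unit_id_neq0 : end_unit_trivial C -> idm 𝟙 <> 0.
Proof.
case=> val valK _ id0; suff: (1 : k) = 0 by move/eqP; rewrite oner_eq0.
by rewrite -(valK 1) -(valK 0) id0 !scaler0.
Qed.

(** Both sides are decomposed into simple objects and Schur's lemma is applied to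
    a nonzero component of [e]; the unit itself is simple because its only
    nonzero idempotent endomorphism is the identity. *)
Lemma unit_quotient_split W (e : hom W 𝟙) :
  end_unit_trivial C -> semisimple C -> e <> 0 ->
  exists s : hom 𝟙 W, e ∘ s = idm 𝟙.
Proof.
move=> unitC [abC ssC] e_neq0; have id_neq0 := unit_id_neq0 unitC.
have [val valK Kval] := unitC.
have [n [S [S_simple [inj [prj [_ _ sumW]]]]]] := ssC W.
have [m [T [T_simple [inj1 [prj1 [pi1 _ sum1]]]]]] := ssC 𝟙.
have /existsP [j /eqP nz_j] : [exists j, inj1 j ∘ prj1 j != 0].
  apply: contra_notT id_neq0; rewrite negb_exists => /forallP all0.
  by rewrite -sum1 big1 // => j _; apply/eqP; rewrite -[_ == _]negbK.
have idem : inj1 j ∘ prj1 j = idm 𝟙.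
  have : (inj1 j ∘ prj1 j) ∘ (inj1 j ∘ prj1 j) = inj1 j ∘ prj1 j.
    by rewrite compA -(compA (inj1 j)) pi1 comp_idr.
  move: nz_j; rewrite -(Kval (inj1 j ∘ prj1 j)); move: (val _) => a a_neq0.
  rewrite compZl comp_idl scalerA => /(can_inj valK) aa.
  have a0 : a != 0 by apply: contra_notN a_neq0 => /eqP ->; rewrite scale0r.
  by rewrite -[a](mulfK a0) aa divff // scale1r.
have /existsP [i /eqP nz_i] : [exists i, e ∘ inj i != 0].
  apply: contra_notT e_neq0; rewrite negb_exists => /forallP all0.
  rewrite -[e]comp_idr -sumW comp_sumr big1 // => i _; rewrite compA.
  by have /eqP -> : e ∘ inj i == 0; rewrite ?comp_0l // -[_ == _]negbK.
have nz_ij : prj1 j ∘ (e ∘ inj i) <> 0.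
  by move=> h; apply: nz_i; rewrite -[_ ∘ _]comp_idl -idem -compA h comp_0r.
have [g [_ fg]] := schur abC (S_simple i) (T_simple j) nz_ij.
exists (inj i ∘ g ∘ prj1 j).
rewrite -[LHS]comp_idl -idem -!compA; congr (_ ∘ _).
by rewrite !compA -(compA _ e) fg comp_idl.
Qed.

End Unit.

(** * Representing objects as left duals *)

Section Dual.

Variables (k : fieldType) (C : monoidal_category k).
Notation "𝟙" := (unit_obj C).
Implicit Types X Y Z : C.

Definition ev X (D : dual_object X) : hom (D ⊗ X) 𝟙 := uncurry (idm D).

Lemma ev_inj X (D : dual_object X) Z (f g : hom Z D) :
  ev D ∘ (f ▷ X) = ev D ∘ (g ▷ X) -> f = g.
Proof.
by rewrite /ev -!uncurry_natural !comp_idl => /(can_inj (@uncurryK _ _ _ D _)).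
Qed.

Lemma ev_dual_map X Y (DX : dual_object X) (DY : dual_object Y) (f : hom X Y) :
  ev DX ∘ (dual_map DX DY f ▷ X) = ev DY ∘ (DY ◁ f).
Proof. by rewrite /ev -uncurry_natural comp_idl /dual_map curryK. Qed.

(** The second zigzag identity is obtained from the first one through the
    universality of [ev D]. *)
Lemma left_dual_of_zigzag X (D : dual_object X) (c : hom 𝟙 (X ⊗ D)) :
  cap (ev D) X ∘ (c ▷ X) = lunit X -> is_left_dual X D.
Proof.
move=> zz; exists (ev D), c; split=> //.
have : lunit D ∘ (ev D ▷ D) ∘ cup c D = idm D.
  by apply: ev_inj; rewrite tensm_id comp_idr; apply: second_zigzag.
rewrite /cup => /(congr1 (fun f => f ∘ runit D)).
by rewrite comp_idl !compA -(compA _ (bwd (runit D))) bwdK comp_idr.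
Qed.

(** An object isomorphic to a representing object is itself representing, so a
    duality proved for all representing objects applies to it directly. *)
Definition dual_object_iso X (D : dual_object X) Y (i : iso D Y) : dual_object X.
Proof.
apply: (@DualObject _ _ X Y (fun Z f => i ∘ curry D f)
                            (fun Z h => uncurry (bwd i ∘ h))).
- by move=> Z f; rewrite compA bwdK comp_idl curryK.
- by move=> Z h; rewrite uncurryK compA fwdK comp_idl.
- by move=> W Z g f; rewrite curry_natural compA.
Defined.

(** The coevaluation of a direct sum is the sum of those of the summands, carried
    into it by the inclusions and by the transposes of the projections; the
    zigzag of the sum then becomes the resolution of the identity. *)
Lemma zigzag_direct_sum n (S : 'I_n -> C) X (D : dual_object X)
    (DS : forall i, dual_object (S i)) :
  is_direct_sum S X ->
  (forall i, exists c, cap (ev (DS i)) (S i) ∘ (c ▷ S i) = lunit (S i)) ->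
  exists c, cap (ev D) X ∘ (c ▷ X) = lunit X.
Proof.
move=> [inj [prj [_ _ sumX]]] /fin_all_exists [c cE].
exists (\sum_i (inj i ⊠ dual_map D (DS i) (prj i)) ∘ c i).
rewrite whiskr_sum comp_sumr -[RHS]comp_idl -[in RHS]sumX comp_suml.
apply: eq_bigr => i _; set p' := dual_map _ _ _.
have -> : inj i ⊠ p' = (inj i ▷ D) ∘ (S i ◁ p').
  by rewrite -tensm_comp comp_idl comp_idr.
rewrite !whiskr_comp -(compA (inj i ▷ D ▷ X)) (compA _ (inj i ▷ D ▷ X)).
rewrite cap_natural -!(compA (inj i)); congr (_ ∘ _).
rewrite -lunit_natural -cE -compA whisk_exchange !compA; congr (_ ∘ _).
rewrite /cap -!compA assoc_naturalm assoc_naturalr !compA; congr (_ ∘ _).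
by rewrite -!compA -!whiskl_comp ev_dual_map.
Qed.

End Dual.

Section DualEquivalence.

Variables (k : fieldType) (C : monoidal_category k).
Implicit Types X Y Z : C.
Variable D : forall X : C, dual_object X.
Hypothesis D_equiv : is_equivalence (dual_functor D).

(** An equivalence is injective on morphisms, so it keeps the identity and the
    zero endomorphism of a nonzero object apart. *)
Lemma dual_id_neq0 X : idm X <> 0 -> idm (D X) <> 0.
Proof.
case: D_equiv => G [[eta eta_nat] _] id_neq0 id0; apply: id_neq0.
have e0 : fmap (dual_functor D) (0 : hom X X) = fmap (dual_functor D) (idm X).
  have [] := id0_zero id0 (D X) => _ all0.
  by rewrite [LHS]all0 [RHS]all0.
apply: (@fwd_surj _ _ _ _ _ (eta X)).
rewrite -[LHS]/(fmap (id_functor C) (idm X) ∘ eta X).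
rewrite -[RHS]/(fmap (id_functor C) 0 ∘ eta X) -!eta_nat.
by congr (_ ∘ fmap G _).
Qed.

Lemma dual_ess_surj X : exists Z, inhabited (iso (D Z) X).
Proof.
case: D_equiv => G [_ [eta _]]; exists (G X); constructor.
have [f g gf fg] := eta X.
exact: (@Iso k C (D (G X)) X g f gf fg).
Qed.

End DualEquivalence.

(** * Rigidity *)

(** The evaluation is a nonzero map to the unit, so it has a section; braiding
    that section gives a coevaluation whose closed loop is [1].  By Schur's lemma the
    zigzag is zero or invertible, and it is not zero because of moderate growth.
    Applying the inverse of the zigzag to the first factor of the coevaluation
    straightens it. *)
Lemma simple_has_zigzag (k : fieldType) (C : braided_category k) (X : C)
    (D : dual_object X) :
  end_unit_trivial C -> semisimple C -> object_moderate_growth X ->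
  simple X -> idm D <> 0 ->
  exists c, cap (ev D) X ∘ (c ▷ X) = lunit X.
Proof.
move=> unitC ssC [n growth] sX D_neq0.
have ev_neq0 : ev D <> 0.
  move=> ev0; apply: D_neq0; apply: (ev_inj (D := D)).
  by rewrite ev0 !comp_0l.
have [s evs] := unit_quotient_split unitC ssC ev_neq0.
pose c := bwd (braid X D) ∘ s.
have loop1 : ev D ∘ braid X D ∘ c = idm _.
  by rewrite /c compA -(compA (ev D)) fwdK comp_idr.
pose z := cap (ev D) X ∘ (c ▷ X) ∘ bwd (lunit X).
have zE : cap (ev D) X ∘ (c ▷ X) = z ∘ lunit X.
  by rewrite /z -[RHS]compA bwdK comp_idr.
have z_neq0 : z <> 0.
  move=> z0; move: growth; rewrite ltnNge (dim_tens_pow_ge loop1) //.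
    by rewrite zE z0 comp_0l.
  exact: unit_id_neq0.
have [w [wz _]] := schur (proj1 ssC) sX sX z_neq0.
exists ((w ▷ D) ∘ c).
by rewrite whiskr_comp compA cap_natural -compA zE compA wz comp_idl.
Qed.

Theorem corollary1p3 (k : fieldType) (C : braided_category k) :
  cauchy_complete C ->
  end_unit_trivial C ->
  semisimple C ->
  r_category C ->
  moderate_growth C ->
  rigid C.
Proof.
move=> _ unitC ssC [D D_equiv] growthC.
have zz (Z : C) (DZ : dual_object Z) :
    exists c, cap (ev DZ) Z ∘ (c ▷ Z) = lunit Z.
  have [n [S [S_simple sumZ]]] := proj2 ssC Z.
  apply: (zigzag_direct_sum (DS := fun i => D (S i)) _ sumZ) => i.
  apply: simple_has_zigzag => //.
    exact/growthC/simple_indecomposable.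
  exact/(dual_id_neq0 D_equiv)/simple_id_neq0.
move=> X; split.
  by have [c /left_dual_of_zigzag] := zz X (D X); exists (D X).
(* A right dual of X is an object whose left dual is X; it exists because every
   object is isomorphic to some representing object. *)
have [Z [i]] := dual_ess_surj D_equiv X.
have [c /left_dual_of_zigzag] := zz Z (dual_object_iso i).
by exists Z.
Qed.
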